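(* Let $k<n$ be positive integers with $k$ dividing $n$. Let $A\in\mathbb C^{n\times n}$ be such that $A=H+[I_k,0]^TZ^H$, where $Z\in\mathbb C^{n\times k}$ and $H\in\mathbb C^{n\times n}$ is unitary block upper Hessenberg with block size $k$. Then there exists a unitary block diagonal matrix $P=\operatorname{blkdiag}[P_1,P_2,\ldots,P_{n/k}]$, with $P_i\in\mathbb C^{k\times k}$ and $P_1=I_k$, such that $\widetilde A=P^HAP$ can be represented in the LFR format as $$\widetilde A=I_n\bigl(I_n+[I_k,0]^T\widehat Z^H\bigr)\widetilde H,$$ where $L=I_n$, $R=\widetilde H=P^HHP$, $F=I_n+[I_k,0]^T\widehat Z^H$ and $\widehat Z^H=Z^HP\widetilde H^H$.
   Context: Notation: $M^H$ is the conjugate transpose; $[I_k,0]^T\in\mathbb C^{n\times k}$ consists of the first $k$ columns of $I_n$. A matrix is upper (lower) Hessenberg if its $(i,j)$ entry vanishes for $i>j+1$ (for $j>i+1$). A matrix $H\in\mathbb C^{n\times n}$ partitioned into $k\times k$ blocks $H_{i,j}$, $1\le i,j\le n/k$, is block upper Hessenberg with block size $k$ if $H_{i,j}=0$ for $i>j+1$. LFR format: a matrix $A\in\mathbb C^{n\times n}$ is represented in the LFR format (with parameter $k$) by a triple $(L,F,R)$ of $n\times n$ matrices if (1) $A=LFR$; (2) $L$ is the product of $k$ unitary lower Hessenberg matrices; (3) $R$ is the product of $k$ unitary upper Hessenberg matrices; (4) $F=Q+[I_k,0]^TY^H$ for some $Y\in\mathbb C^{n\times k}$, where $Q=\begin{bmatrix}I_k&0\\0&\hat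 Q\end{bmatrix}$ is block diagonal unitary with $\hat Q$ unitary Hessenberg. *)

(* Defs.v *)
From HB Require Import structures.
From mathcomp Require Import all_boot all_order all_algebra.
From mathcomp Require Import sesquilinear spectral.
From mathcomp Require Import reals complex.

Set Implicit Arguments.
Unset Strict Implicit.
Unset Printing Implicit Defensive.

Import GRing.Theory Num.Theory.
Local Open Scope ring_scope.
Local Open Scope sesquilinear_scope.

(* Indices start at 0, which leaves the conditions i > j + 1 and j > i + 1
   unchanged. *)
Definition upper_hessenberg (T : nmodType) n (A : 'M[T]_n) : Prop :=
  forall i j : 'I_n, (j.+1 < i)%N -> A i j = 0.

Definition lower_hessenberg (T : nmodType) n (A : 'M[T]_n) : Prop :=
  forall i j : 'I_n, (i.+1 < j)%N -> A i j = 0.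

Section Blocks.
Variables (T : nmodType) (k n : nat).

(* MathComp types a matrix cut into n / k blocks of size k by the sum of the
   block sizes; this equation casts between that type and 'M_n. *)
Lemma sum_block_sizes : (k %| n)%N -> (\sum_(i < n %/ k) k)%N = n.
Proof. by move=> kn; rewrite sum_nat_const card_ord divnK. Qed.

Definition block_of (kn : (k %| n)%N) (A : 'M[T]_n) (i j : 'I_(n %/ k)) :
    'M[T]_k :=
  let e := esym (sum_block_sizes kn) in submxblock (castmx (e, e) A) i j.

Definition block_upper_hessenberg (kn : (k %| n)%N) (A : 'M[T]_n) : Prop :=
  forall i j : 'I_(n %/ k), (j.+1 < i)%N -> block_of kn A i j = 0.

Definition blkdiag (kn : (k %| n)%N) (P : 'I_(n %/ k) -> 'M[T]_k) : 'M[T]_n :=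
  let e := sum_block_sizes kn in castmx (e, e) (\mxdiag_i P i).

End Blocks.

(* [I_k, 0]^T, the first k columns of I_n when k <= n. *)
Definition first_cols (T : pzSemiRingType) n k : 'M[T]_(n, k) := pid_mx k.

(* Q = diag(I_k, Qhat) *)
Definition id_block_mx (T : pzSemiRingType) k n (kn : (k <= n)%N)
    (Qhat : 'M[T]_(n - k)) : 'M[T]_n :=
  let e := subnKC kn in castmx (e, e) (block_mx 1%:M 0 0 Qhat).

(* Qhat is "Hessenberg" without qualification, which means upper. *)
Definition is_LFR (C : numClosedFieldType) k n (kn : (k <= n)%N)
    (A L F R : 'M[C]_n) : Prop :=
  [/\ A = L *m F *m R,
      exists2 G : 'I_k -> 'M[C]_n,
        forall i, G i \is unitarymx /\ lower_hessenberg (G i)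
        & L = \prod_(i < k) G i,
      exists2 G : 'I_k -> 'M[C]_n,
        forall i, G i \is unitarymx /\ upper_hessenberg (G i)
        & R = \prod_(i < k) G i
    & exists (Y : 'M[C]_(n, k)) (Qhat : 'M[C]_(n - k)),
        [/\ Qhat \is unitarymx, upper_hessenberg Qhat
          & F = id_block_mx kn Qhat + first_cols C n k *m Y ^t*]].

(* Main.v *)
Require Import Defs.
From mathcomp Require Import all_boot all_order all_algebra.
From mathcomp Require Import sesquilinear spectral.
From mathcomp Require Import reals complex.
From mathcomp Require Import zify.

Import GRing.Theory Num.Theory.
Local Open Scope ring_scope.
Local Open Scope sesquilinear_scope.

(** Choosing the P_i recursively by QR factorizations of the subdiagonal blocks
    makes the subdiagonal blocks of P^H H P upper triangular, so that P^H H P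
    vanishes below its k-th subdiagonal.  Left multiplication by a lower
    Hessenberg product of Givens rotations removes the lowest nonzero
    subdiagonal of a matrix, so k - 1 such steps split off k - 1 unitary upper
    Hessenberg factors and leave a unitary upper Hessenberg one. *)

Section Unitary.
Set Implicit Arguments.
Unset Strict Implicit.
Variable C : numClosedFieldType.

(** Bandwidth 0 means upper triangular and bandwidth 1 upper Hessenberg. *)
Definition lower_banded m n (b : nat) (A : 'M[C]_(m, n)) :=
  forall (i : 'I_m) (j : 'I_n), (j + b < i)%N -> A i j = 0.

Lemma trmxCK m n (A : 'M[C]_(m, n)) : (A ^t*) ^t* = A.
Proof. by apply/matrixP=> i j; rewrite !mxE conjCK. Qed.

Lemma trmxC_mul m n p (A : 'M[C]_(m, n)) (B : 'M[C]_(n, p)) :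
  (A *m B) ^t* = B ^t* *m A ^t*.
Proof. by rewrite trmx_mul map_mxM. Qed.

Lemma unitarymx1 n : (1%:M : 'M[C]_n) \is unitarymx.
Proof. by apply/unitarymxP; rewrite trmx1 map_mx1 mulmx1. Qed.

Lemma unitarymxPC n (A : 'M[C]_n) : A \is unitarymx -> A ^t* *m A = 1%:M.
Proof. by move/unitarymxP/mulmx1C. Qed.

Lemma castmx1 m n (e : m = n) : castmx (e, e) 1%:M = 1%:M :> 'M[C]_n.
Proof. by case: n / e. Qed.

(** * QR factorization by Gram-Schmidt *)

Definition qr_mx m (A : 'M[C]_m) : 'M[C]_m := schmidt (A ^t*).

Lemma qr_mx_unitary m (A : 'M[C]_m) : qr_mx A \is unitarymx.
Proof. exact: schmidt_unitarymx. Qed.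

(** [qr_mx A] is the adjoint of the unitary QR factor of [A]. Row [j] of [A ^t*] lies in the span of
    the first [j + 1] orthonormalized rows, and row [i > j] is orthogonal to these. *)
Lemma qr_mxP m (A : 'M[C]_m) : lower_banded 0 (qr_mx A *m A).
Proof.
move=> i j; rewrite addn0 => lt_ji; set B := qr_mx A.
have sub : (row j (A ^t*) <= kermx ((row i B) ^t*))%MS.
  apply: submx_trans (row_schmidt_sub _ _) _.
  apply/sumsmx_subP => l le_lj; rewrite genmxE; apply/sub_kermxP.
  apply/matrixP => a b; rewrite !mxE.
  have /unitarymxP/matrixP/(_ l i) := qr_mx_unitary A.
  have /negbTE ne_li : l != i.
    by apply/eqP => eq_li; move: lt_ji; rewrite -eq_li ltnNge le_lj.
  rewrite !mxE ne_li mulr0n; apply: etrans.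
  by apply: eq_bigr => c _; rewrite !mxE.
move/sub_kermxP/matrixP/(_ 0 0): sub => eq0.
(* The orthogonality relation is the conjugate of the wanted entry. *)
have := congr1 Num.conj eq0.
rewrite [in RHS]mxE rmorph0; apply: etrans; rewrite !mxE rmorph_sum.
by apply: eq_bigr => c _; rewrite !mxE rmorphM /= !conjCK mulrC.
Qed.

(* Acts as w on the coordinates listed by f and as the identity elsewhere. *)
Definition embed_mx m n (f : 'I_m -> 'I_n) (w : 'M[C]_m) : 'M[C]_n :=
  1%:M + colsub f 1%:M *m (w - 1%:M) *m rowsub f 1%:M.

(** * Unitary matrices acting on selected coordinates *)

Section Embed.
Variables (m n : nat) (f : 'I_m -> 'I_n) (w : 'M[C]_m).
Hypothesis f_inj : injective f.

Lemma rowsub_colsub1 : rowsub f 1%:M *m colsub f 1%:M = 1%:M :> 'M[C]_m.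
Proof.
apply/matrixP => i j; rewrite mul_rowsub_mx mul1mx !mxE.
by rewrite (inj_eq f_inj).
Qed.

Lemma rowsub1_embed_mx : rowsub f 1%:M *m embed_mx f w = w *m rowsub f 1%:M.
Proof.
rewrite /embed_mx mulmxDr mulmx1 !mulmxA rowsub_colsub1 mul1mx mulmxBl mul1mx.
by rewrite addrC subrK.
Qed.

Lemma rowsub_embed_mx p (M : 'M[C]_(n, p)) :
  rowsub f (embed_mx f w *m M) = w *m rowsub f M.
Proof.
rewrite -[embed_mx f w *m M]mul1mx -[M in RHS]mul1mx -!mul_rowsub_mx.
by rewrite !mulmxA rowsub1_embed_mx.
Qed.

Lemma embed_mx_notin p (M : 'M[C]_(n, p)) i j :
  (forall a, f a != i) -> (embed_mx f w *m M) i j = M i j.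
Proof.
move=> f_i; rewrite /embed_mx mulmxDl mul1mx mxE -!mulmxA.
rewrite [X in _ + X]mxE big1 ?addr0 // => a _.
by rewrite !mxE eq_sym (negbTE (f_i a)) mul0r.
Qed.

Lemma embed_mx_unitary : w \is unitarymx -> embed_mx f w \is unitarymx.
Proof.
move=> /unitarymxP w_unitary; set E := colsub f 1%:M : 'M[C]_(n, m).
have Et : E ^t* = rowsub f 1%:M.
  by apply/matrixP => i j; rewrite !mxE conjC_nat eq_sym.
have W : embed_mx f w = 1%:M + E *m (w - 1%:M) *m E ^t* by rewrite Et.
apply/unitarymxP.
have WC : (embed_mx f w) ^t* = 1%:M + E *m (w ^t* - 1%:M) *m E ^t*.
  rewrite W linearD map_mxD /= !trmxC_mul trmxCK trmx1 map_mx1 mulmxA.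
  by rewrite linearB map_mxB /= trmx1 map_mx1.
(* With [D = w - 1], this sum is [w *m w ^t* - 1]. Since [E ^t* *m E = 1], it is also the middle
   factor left over when the product of [1 + E D E ^t*] with its adjoint is expanded. *)
have DD : w - 1%:M + (w ^t* - 1%:M) + (w - 1%:M) *m (w ^t* - 1%:M) = 0.
  rewrite mulmxBl mul1mx mulmxBr mulmx1 w_unitary.
  by rewrite -(opprB w) -opprD subrr.
have EDE : E *m (w - 1%:M) *m E ^t* *m (E *m (w ^t* - 1%:M) *m E ^t*)
    = E *m ((w - 1%:M) *m (w ^t* - 1%:M)) *m E ^t*.
  rewrite !mulmxA; congr (_ *m _ *m _).
  by rewrite -[LHS]mulmxA Et rowsub_colsub1 mulmx1.
rewrite WC W; move: (w - _) (w ^t* - _) DD EDE => D D' DD EDE.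
rewrite mulmxDl !mulmxDr mul1mx mulmx1 mul1mx EDE -addrA.
rewrite [X in _ + X]addrA -!mulmxDl -!mulmxDr (addrC D') DD.
by rewrite mulmx0 mul0mx addr0.
Qed.

End Embed.

Lemma givens n (p q : 'I_n) (z : 'cV[C]_n) : p != q ->
  exists W : 'M[C]_n,
    [/\ W \is unitarymx,
        forall m (M : 'M[C]_(n, m)) i j, i != p -> i != q ->
          (W *m M) i j = M i j,
        forall m (M : 'M[C]_(n, m)) i j, i = p \/ i = q ->
          M p j = 0 -> M q j = 0 -> (W *m M) i j = 0
      & (W *m z) q 0 = 0].
Proof.
move=> ne_pq; pose f (a : 'I_2) := if a == 0 then p else q.
have f_inj : injective f.
  move=> a b; rewrite /f.
  case: a => [[|[|//]] ?]; case: b => [[|[|//]] ?] //=;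
    try by move=> _; apply: val_inj.
    by move/eqP; rewrite (negbTE ne_pq).
  by move/eqP; rewrite eq_sym (negbTE ne_pq).
(* The two selected entries of [z] are padded with a zero column to a square matrix; triangularizing
   it annihilates the second entry. *)
pose A : 'M[C]_(1 + 1) := row_mx (rowsub f z) 0; exists (embed_mx f (qr_mx A)).
have rowE m (M : 'M[C]_(n, m)) (a : 'I_2) j :
    (embed_mx f (qr_mx A) *m M) (f a) j = (qr_mx A *m rowsub f M) a j.
  by rewrite -rowsub_embed_mx // [RHS]mxE.
split.
- exact/embed_mx_unitary/qr_mx_unitary.
- move=> m M i j ne_ip ne_iq; apply: embed_mx_notin => a.
  by rewrite /f eq_sym; case: ifP.
- move=> m M i j i_pq Mp0 Mq0.
  have [a ->] : exists a, i = f a.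
    by case: i_pq => ->; [exists 0 | exists 1].
  rewrite rowE mxE big1 // => b _; rewrite [rowsub f M b j]mxE /f.
  by case: ifP; rewrite ?Mp0 ?Mq0 mulr0.
have <- : f 1 = q by [].
rewrite rowE.
have /(_ 1 (lshift 1 0) isT) := @qr_mxP _ A.
by rewrite {2}/A mul_mx_row row_mxEl.
Qed.

(** * Factoring banded unitary matrices *)

Lemma lower_banded_peel n b (U : 'M[C]_n) : lower_banded b.+1 U ->
  exists K : 'M[C]_n,
    [/\ K \is unitarymx, lower_hessenberg K & lower_banded b (K *m U)].
Proof.
move=> U_band.
(* K is the product of the first t rotations: the one of step t acts on rows
   b + t and b + t + 1 and annihilates the entry (b + t + 1, t), so that columns
   0 to t - 1 of K U already have bandwidth b. *)
suff /(_ n) [K [? ? _ KU]] : forall t, exists K : 'M[C]_n,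
    [/\ K \is unitarymx, lower_hessenberg K,
        forall i j : 'I_n, (b + t < i)%N || (b + t < j)%N -> K i j = (i == j)%:R
      & forall i j : 'I_n, (j + b < i)%N -> (j < t)%N || (j + b.+1 < i)%N ->
          (K *m U) i j = 0].
  by exists K; split=> // i j lt_ji; apply: KU => //; rewrite ltn_ord.
elim=> [|t [K [K_unitary K_hess K_id KU]]].
  exists 1%:M; split=> [||i j _|i j _ /= lt_ji].
  - exact: unitarymx1.
  - move=> i j lt_ij; rewrite mxE; case: eqP lt_ij => // ->.
    by rewrite ltnNge leqW.
  - by rewrite mxE.
  - by rewrite mul1mx U_band.
(* Once row [b + t + 1] falls outside the matrix, nothing is left to annihilate and [K] is kept. *)
have [lt_tn | le_nt] := ltnP (b + t).+1 n; last first.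
  exists K; split=> // i j.
    by move=> lt_ij; apply: K_id; lia.
  by move=> lt_ji le_jt; apply: KU => //; have := ltn_ord i; lia.
pose p := Ordinal (ltnW lt_tn); pose q := Ordinal lt_tn.
have lt_t : (t < n)%N by lia.
pose c := Ordinal lt_t.
have ne_pq : p != q by rewrite -val_eqE /= neq_ltn ltnSn.
have [W [W_unitary W_out W_in W_z]] := givens (col c (K *m U)) ne_pq.
have nE (i j : 'I_n) : (i == j) = (i == j :> nat) by [].
have row_cases (i : 'I_n) :
    [/\ i = p \/ i = q, (b + t <= i)%N & (i <= (b + t).+1)%N]
    \/ [/\ i != p, i != q & i = (b + t).+1 :> nat -> False].
  have [->|ne_ip] := eqVneq i p; first by left; split; [left | |] => //=; lia.
  have [->|ne_iq] := eqVneq i q; first by left; split; [right | |] => //=; lia.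
  by right; split=> // eq_i; case/eqP: ne_iq; apply: val_inj.
(* Beyond index [b + t] the matrix [K] is still the identity, so mixing rows [p] and [q] fills
   nothing to the right of column [q]. *)
have K0 (i j : 'I_n) : i = p \/ i = q -> ((b + t).+1 < j)%N -> K i j = 0.
  move=> i_pq lt_j; rewrite K_id; last by lia.
  have le_i : (i <= (b + t).+1)%N by case: i_pq => ->.
  by rewrite nE ltn_eqF ?mulr0n // (leq_ltn_trans le_i).
exists (W *m K); split.
- exact: mul_unitarymx.
- move=> i j lt_ij; have [[i_pq ge_i _]|[ne_ip ne_iq _]] := row_cases i.
    have lt_j : ((b + t).+1 < j)%N by lia.
    by apply: W_in => //; apply: K0 => //; [left | right].
  by rewrite W_out // K_hess.
- move=> i j lt_ij; have [[i_pq _ le_i]|[ne_ip ne_iq _]] := row_cases i.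
    have lt_j : ((b + t).+1 < j)%N by lia.
    rewrite nE ltn_eqF ?mulr0n ?(leq_ltn_trans le_i) //.
    by apply: W_in => //; apply: K0 => //; [left | right].
  by rewrite W_out // K_id //; lia.
move=> i j lt_ji le_jt; rewrite -mulmxA.
have [[i_pq ge_i le_i]|[ne_ip ne_iq ne_i]] := row_cases i; last first.
  by rewrite W_out // KU //; lia.
(* The bounds force [j <= t]. For [j < t] both rows [p] and [q] of [K *m U] already vanish in column
   [j]; for [j = t] only row [q] is concerned, which the rotation was built for. *)
have [eq_jt|ne_jt] := eqVneq (j : nat) t; last first.
  by apply: W_in => //; apply: KU => //=; lia.
have -> : i = q by apply: val_inj => /=; lia.
have -> : j = c by apply: val_inj.
by move: W_z; rewrite colE !mulmxA -colE mxE.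
Qed.

(** By induction on [b]: [U = K ^t* *m (K *m U)], where [K ^t*] is upper Hessenberg and [K *m U] has
    smaller bandwidth. *)
Lemma upper_hessenberg_factors n b (U : 'M[C]_n) :
  (0 < b)%N -> U \is unitarymx -> lower_banded b U ->
  exists2 G : 'I_b -> 'M[C]_n,
    forall i, G i \is unitarymx /\ upper_hessenberg (G i)
    & U = \prod_(i < b) G i.
Proof.
case: b => // b _; elim: b U => [|b IHb] U U_unitary U_band.
  exists (fun=> U) => [_|]; last by rewrite big_ord1.
  by split=> // i j lt_ji; apply: U_band; rewrite addn1.
have [K [K_unitary K_hess /IHb[|G G_hess KU]]] := lower_banded_peel U_band.
  exact: mul_unitarymx.
exists (fun i => oapp G (K ^t*) (unlift ord0 i)) => [i|].
  case: (unlift ord0 i) => //=; rewrite trmxC_unitary; split=> // a c lt_ca.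
  by rewrite !mxE K_hess // conjC0.
rewrite big_ord_recl unlift_none /=.
under eq_bigr do rewrite liftK /=.
by rewrite -KU -[LHS]mul1mx -(unitarymxPC K_unitary) -mulmxA.
Qed.

(** * Block diagonal reduction of block Hessenberg matrices *)

Section ConstantBlocks.
Variables q k : nat.

Lemma index_sig (s : 'I_(\sum_(i < q) k)) :
  s = (tagnat.sig1 s * k + tagnat.sig2 s)%N :> nat.
Proof.
rewrite [LHS]tagnat.rect; congr (_ + _)%N.
rewrite -(big_ord_widen _ (fun=> k)); last exact/ltnW/ltn_ord.
by rewrite sum_nat_const card_ord.
Qed.

Lemma mxdiag_trC (D : 'I_q -> 'M[C]_k) :
  (\mxdiag_i D i) ^t* = \mxdiag_i (D i) ^t*.
Proof.
rewrite tr_mxdiag; apply/matrixP => s t; rewrite !mxE.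
by case: eqP => _; rewrite ?conform_mx_id !mxE ?conjC0.
Qed.

Lemma mxdiag_unitary (D : 'I_q -> 'M[C]_k) :
  (forall i, D i \is unitarymx) -> \mxdiag_i D i \is unitarymx.
Proof.
move=> D_unitary; apply/unitarymxP; rewrite mxdiag_trC mul_mxdiag_mxblock.
rewrite -mxdiagZ; apply/eq_mxblock => i j; case: eqVneq => _.
  by rewrite !conform_mx_id; apply/unitarymxP.
by rewrite mulmx0.
Qed.

Lemma pid_mx_mxcol :
  pid_mx k = \mxcol_(i < q) ((if i == 0%N :> nat then 1%:M else 0) : 'M_k)
    :> 'M[C]_(\sum_(i < q) k, k).
Proof.
apply/matrixP => s c; rewrite !mxE index_sig.
have lt_k : (tagnat.sig2 s < k)%N by [].
case: (nat_of_ord (tagnat.sig1 s)) => [|a] /=.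
  by rewrite mxE mul0n add0n lt_k andbT.
by rewrite mxE (_ : (_ < k)%N = false) ?andbF //; nia.
Qed.

(** With [B j] the block of [H] at [(j + 1, j)], the next unitary is the QR factor of [B j] times
    the current one, which makes the transformed block triangular. *)
Fixpoint qr_chain (B : nat -> 'M[C]_k) (i : nat) : 'M[C]_k :=
  if i is j.+1 then (qr_mx (B j *m qr_chain B j)) ^t* else 1%:M.

Lemma qr_chain_unitary B i : qr_chain B i \is unitarymx.
Proof.
by case: i => [|i] /=; rewrite ?trmxC_unitary ?qr_mx_unitary ?unitarymx1.
Qed.

Lemma block_hessenberg_reduction (H : 'M[C]_(\sum_(i < q) k)) :
  (forall i j : 'I_q, (j.+1 < i)%N -> submxblock H i j = 0) ->
  exists P_ : 'I_q -> 'M[C]_k, let P := \mxdiag_i P_ i in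
    [/\ forall i : 'I_q, i = 0%N :> nat -> P_ i = 1%:M,
        P \is unitarymx, P *m pid_mx k = pid_mx k :> 'M_(_, k)
      & lower_banded k (P ^t* *m H *m P)].
Proof.
move=> H_hess.
(* The subdiagonal blocks, extended by 0 to all naturals for the recursion. *)
pose B a : 'M[C]_k := if (insub a.+1, insub a) is (Some i, Some j)
  then submxblock H i j else 0.
have BE (i j : 'I_q) : i = j.+1 :> nat -> B j = submxblock H i j.
  by move=> eq_i; rewrite /B -eq_i !valK.
exists (fun i => qr_chain B i); split.
- by move=> i ->.
- by apply: mxdiag_unitary => i; apply: qr_chain_unitary.
- rewrite pid_mx_mxcol mul_mxdiag_mxcol; apply/eq_mxcol => i.
  by case: eqP => [->|_]; rewrite /= ?mulmx1 ?mulmx0.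
rewrite mxdiag_trC -[H]submxblockK mul_mxdiag_mxblock mul_mxblock_mxdiag.
move=> s t; rewrite !index_sig mxE.
move: (tagnat.sig1 s) (tagnat.sig2 s) (tagnat.sig1 t) (tagnat.sig2 t).
move=> i a j b lt_ts.
have [lt_ij|] := ltnP j.+1 i.
  by rewrite H_hess // mulmx0 mul0mx mxE.
(* On or above the block diagonal, a row index exceeds the column index by less than [k], which
   contradicts [lt_ts]. *)
rewrite leq_eqVlt => /orP[/eqP eq_ij|le_ij]; last first.
  by have := ltn_ord a; nia.
rewrite -BE // eq_ij /= trmxCK -mulmxA qr_mxP //.
by move: lt_ts; rewrite eq_ij; lia.
Qed.

End ConstantBlocks.

(** Keeping [n] a variable lets case analysis on [e] erase the casts. *)
Lemma castmx_block_hessenberg_reduction q k n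
    (e : (\sum_(i < q) k)%N = n) (H : 'M[C]_n) :
  (forall i j : 'I_q, (j.+1 < i)%N ->
     submxblock (castmx (esym e, esym e) H) i j = 0) ->
  exists P_ : 'I_q -> 'M[C]_k, let P := castmx (e, e) (\mxdiag_i P_ i) in
    [/\ forall i : 'I_q, i = 0%N :> nat -> P_ i = 1%:M,
        P \is unitarymx, P *m pid_mx k = pid_mx k :> 'M_(n, k)
      & lower_banded k (P ^t* *m H *m P)].
Proof. by case: n / e H => H; apply: block_hessenberg_reduction. Qed.

End Unitary.

Theorem theorem2p6 (R : realType) (k n : nat) (k_gt0 : (0 < k)%N)
    (k_lt_n : (k < n)%N) (k_dvd_n : (k %| n)%N)
    (A H : 'M[R[i]]_n) (Z : 'M[R[i]]_(n, k))
    (H_unitary : H \is unitarymx)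
    (H_hess : block_upper_hessenberg k_dvd_n H)
    (A_eq : A = H + first_cols R[i] n k *m Z ^t*) :
  exists P_ : 'I_(n %/ k) -> 'M[R[i]]_k,
    let P := blkdiag k_dvd_n P_ in
    let Htilde := P ^t* *m H *m P in
    [/\ forall i : 'I_(n %/ k), i = 0%N :> nat -> P_ i = 1%:M,
        P \is unitarymx
      & exists2 Zhat : 'M[R[i]]_(n, k),
          Zhat ^t* = Z ^t* *m P *m Htilde ^t*
          & is_LFR (ltnW k_lt_n) (P ^t* *m A *m P)
              1%:M (1%:M + first_cols R[i] n k *m Zhat ^t*) Htilde].
Proof.
have [P_ [P_0 P_unitary PE P_band]] :=
  castmx_block_hessenberg_reduction H_hess.
exists P_ => P Htilde; split=> //.
rewrite -[castmx _ _]/P in P_unitary PE P_band.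
have Ht_unitary : Htilde \is unitarymx.
  by rewrite !mul_unitarymx // trmxC_unitary.
exists ((Z ^t* *m P *m Htilde ^t*) ^t*); first exact: trmxCK.
split.
- rewrite trmxCK mul1mx mulmxDl mul1mx A_eq mulmxDr mulmxDl; congr (_ + _).
  (* [Htilde ^t* *m Htilde] cancels. It remains that [P ^t*] fixes the first [k] columns of the
     identity, which follows from [PE]. *)
  rewrite -!mulmxA (unitarymxPC Ht_unitary) mulmx1 !mulmxA; congr (_ *m _ *m _).
  by rewrite /first_cols -{1}PE mulmxA (unitarymxPC P_unitary) mul1mx.
- exists (fun=> 1%:M) => [_|]; last by rewrite big1.
  split=> [|i j lt_ij]; first exact: unitarymx1.
  by rewrite mxE -val_eqE /= ltn_eqF // ltnW.
- exact: upper_hessenberg_factors.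
- exists ((Z ^t* *m P *m Htilde ^t*) ^t*), 1%:M; split.
  + exact: unitarymx1.
  + by move=> i j lt_ji; rewrite mxE -val_eqE /= gtn_eqF // ltnW.
  + congr (_ + _); by rewrite /id_block_mx -scalar_mx_block castmx1.
Qed.
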